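(* Let $\mathscr{L}$ be a variadic language. If $t$ is a term of $\mathscr{L}$ which is substitutable for the variable $x$ in the $\mathscr{L}$-formula $\phi$, and $s$ is an assignment and $\mathscr{M}$ a structure for $\mathscr{L}$, then $\mathscr{M}\models\phi(x|t)[s]$ if and only if $\mathscr{M}\models\phi[s(x|t^s)]$.
   Context: $\mathbb{N}=\{0,1,2,\dots\}$ and $\mathbb{N}^{<\mathbb{N}}$ is the set of finite sequences of naturals. Variadic language: a first-order language, including a constant symbol $\mathbf{n}$ for every $n\in\mathbb{N}$, together with a set of variadic function symbols, and a special symbol $\cdots_x$ for every variable $x$. Every language is assumed to satisfy: (1) every symbol is exactly one of: a left parenthesis, a right parenthesis, a logical connective, $=$, a constant symbol, a variable, an $n$-ary predicate symbol for some $n$, an $n$-ary function symbol for some $n$, a variadic function symbol, or an ellipsis $\cdots_x$ for some variable $x$; (2) if a symbol is an $n$-ary function (resp. predicate) symbol and an $m$-ary function (resp. predicate) symbol then $n=m$; (3) if a symbol is both $\cdots_x$ and $\cdots_y$ then $x$ and $y$ are the same variable. (So terms are uniquely readable.) Structure for $\mathscr{L}$: a structure $\mathscr{M}$ for the first-order part of $\mathscr{L}$, with universe $\mathbb{N}$, interpreting each $\mathbf{n}$ as $n$, together with a function $G^{\mathscr{M}}:\mathbb{N}^{<\mathbb{N}}\to\mathbb{N}$ for every variadic function symbol $G$. For $n\in\mathbb{N}$, $\overline{n}$ also denotes the constant symbol $\mathbf{n}$. Terms and their free variables: a constant symbol $c$ is a term, $FV(c)=\emptyset$; a variable $x$ is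 a term, $FV(x)=\{x\}$; if $f$ is an $n$-ary or variadic function symbol and $u_1,\dots,u_n$ are terms then $f(u_1,\dots,u_n)$ is a term with free variables $FV(u_1)\cup\cdots\cup FV(u_n)$; if $G$ is a variadic function symbol, $u,v$ are terms and $x$ is a variable then $G(u(\mathbf{0})\cdots_x u(v))$ is a term (a purely formal expression built from $G,u,x,v$) with free variables $(FV(u)\setminus\{x\})\cup FV(v)$. Term substitution $r(x|t)$ (substituting $t$ for $x$ in $r$): $c(x|t)=c$ for constants; $x(x|t)=t$; $y(x|t)=y$ for variables $y\neq x$; $f(u_1,\dots,u_n)(x|t)=f(u_1(x|t),\dots,u_n(x|t))$; if $r$ is $G(u(\mathbf{0})\cdots_x u(v))$ then $r(x|t)$ is $G(u(\mathbf{0})\cdots_x u(v(x|t)))$; if $r$ is $G(u(\mathbf{0})\cdots_y u(v))$ with $y\neq x$ then $r(x|t)$ is $G(u(x|t)(\mathbf{0})\cdots_y u(x|t)(v(x|t)))$, i.e. the formal expression built from $G$, $u(x|t)$, $y$, $v(x|t)$. Assignment: a function $s$ from variables to the universe $\mathbb{N}$; $s(x|n)$ is the assignment agreeing with $s$ except that it maps $x$ to $n$. (Syntactic) interpretation $t^s\in\mathbb{N}$ of a term, by recursion on complexity: $c^s=c^{\mathscr{M}}$; $x^s=s(x)$; $f(u_1,\dots,u_k)^s=f^{\mathscr{M}}(u_1^s,\dots,u_k^s)$; and $G(u(\mathbf{0})\cdots_x u(v))^s=G^{\mathscr{M}}(u(x|\mathbf{0})^s,u(x|\mathbf{1})^s,\dots,u(x|\overline{v^s})^s)$,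 a sequence of $v^s+1$ arguments. Substitutability of $t$ for $x$ in a term $r$, inductively: if $r$ is a variable or constant symbol, $t$ is substitutable for $x$ in $r$; if $r$ is $f(u_1,\dots,u_n)$ with $f$ $n$-ary or variadic, $t$ is substitutable for $x$ in $r$ iff it is in all the $u_i$; if $r$ is $G(u(\mathbf{0})\cdots_y u(v))$ ($y$ may or may not be $x$), $t$ is substitutable for $x$ in $r$ iff at least one of: $x$ is not a free variable of $r$; or $y=x$ and $t$ is substitutable for $x$ in $v$; or $y$ is not a free variable of $t$ and $t$ is substitutable for $x$ in both $u$ and $v$. Formulas over $\mathscr{L}$ are the first-order formulas built from atomic formulas $p(u_1,\dots,u_n)$ ($p$ a predicate symbol) and $u=v$, where $u_i,u,v$ are terms of the variadic language $\mathscr{L}$ (constant symbols, variables, terms formed by applying an $n$-ary or variadic function symbol to finitely many terms, and ellipsis terms $G(w(\mathbf{0})\cdots_y w(w'))$ with $G$ a variadic function symbol, $w,w'$ terms and $y$ a variable), using connectives and quantifiers. Substitution of a term for (free occurrences of) a variable in a formula, written $\phi(x|t)$, is defined as usual. Satisfaction $\mathscr{M}\models\phi[s]$: $\mathscr{M}\models (u=v)[s]$ iff $u^s=v^s$; predicate symbols are evaluated at the values $u_i^s$; connectives and quantifiers as in ordinary first-order logic. Substitutability of $t$ for $x$ in a formula is defined as usual (in particular for a quantified formula $Qy\,\psi$: either $x$ is not free in $Qy\,\psi$, or $y$ is not free in $t$ and $t$ is substitutable for $x$ in $\psi$), except that $t$ is substitutable for $x$ in an atomic formula $p(u_1,\dots,u_n)$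 ($p$ a predicate symbol or $=$) iff $t$ is substitutable for $x$ in each term $u_i$. *)

(* Defs.v *)
From HB Require Import structures.
From mathcomp Require Import all_boot.

Set Implicit Arguments.
Unset Strict Implicit.
Unset Printing Implicit Defensive.

(* Constant symbols, variables, n-ary function symbols, predicate symbols and
   variadic function symbols live in separate types, and the arity is a
   function of the symbol, so unique readability is automatic.  The ellipsis
   symbols need no type of their own: they are the variables recorded in the
   constructor [Ellipsis] below. *)
Record language := Language {
  var : eqType;
  cst : Type;
  num : nat -> cst;
  num_inj : injective num;
  fsym : Type;
  fsym_arity : fsym -> nat;
  psym : Type;
  psym_arity : psym -> nat;
  vsym : Type
}.

(* [Ellipsis G u x v] is the formal expression G(u(0) ..._x u(v)). *)
Inductive term (L : language) : Type :=
| Cst of cst L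
| Var of var L
| App (f : fsym L) of {ffun 'I_(fsym_arity f) -> term L}
| VApp of vsym L & seq (term L)
| Ellipsis of vsym L & term L & var L & term L.

Arguments Cst {L} c.
Arguments Var {L} x.
Arguments App {L} f us.
Arguments VApp {L} G us.
Arguments Ellipsis {L} G u x v.

Inductive formula (L : language) : Type :=
| Pred (p : psym L) of {ffun 'I_(psym_arity p) -> term L}
| Equal of term L & term L
| Not of formula L
| And of formula L & formula L
| Or of formula L & formula L
| Imp of formula L & formula L
| Iff of formula L & formula L
| All of var L & formula L
| Ex of var L & formula L.

Arguments Pred {L} p us.

Record structure (L : language) := Structure {
  cst_I : cst L -> nat;
  num_I : forall n, cst_I (num L n) = n;
  fsym_I : forall f : fsym L, {ffun 'I_(fsym_arity f) -> nat} -> nat;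
  psym_I : forall p : psym L, {ffun 'I_(psym_arity p) -> nat} -> Prop;
  vsym_I : vsym L -> seq nat -> nat
}.

Definition assignment (L : language) := var L -> nat.

Definition update (L : language) (s : assignment L) (x : var L) (n : nat) :
    assignment L :=
  fun y => if y == x then n else s y.

(* Finite sets of variables are represented by lists; only membership matters. *)
Fixpoint fv (L : language) (r : term L) : seq (var L) :=
  match r with
  | Cst _ => [::]
  | Var x => [:: x]
  | App f us => flatten [seq fv (us i) | i <- enum 'I_(fsym_arity f)]
  | VApp _ us => flatten [seq fv u | u <- us]
  | Ellipsis _ u x v => [seq y <- fv u | y != x] ++ fv v
  end.

(* [tsubst r x t] is r(x|t). *)
Fixpoint tsubst (L : language) (r : term L) (x : var L) (t : term L) : term L :=
  match r with
  | Cst c => Cst c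
  | Var y => if y == x then t else Var y
  | App f us => App f [ffun i => tsubst (us i) x t]
  | VApp G us => VApp G [seq tsubst u x t | u <- us]
  | Ellipsis G u y v =>
      if y == x then Ellipsis G u y (tsubst v x t)
      else Ellipsis G (tsubst u x t) y (tsubst v x t)
  end.

Fixpoint complexity (L : language) (r : term L) : nat :=
  match r with
  | Cst _ | Var _ => 0
  | App f us => (\max_(i < fsym_arity f) complexity (us i)).+1
  | VApp _ us => (foldr maxn 0 [seq complexity u | u <- us]).+1
  | Ellipsis _ u _ v => (maxn (complexity u) (complexity v)).+1
  end.

(* The clause for ellipsis terms calls the interpretation on u(x|n), which is
   not a subterm, so the recursion is on a bound [k] for the complexity; the
   values 0 below are reached only if the bound is too small.  The lemmas
   [interp_Cst] ... [interp_Ellipsis] are the actual recursion equations. *)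
Fixpoint interp_rec (L : language) (M : structure L) (k : nat)
    (s : assignment L) (r : term L) : nat :=
  match r, k with
  | Cst c, _ => cst_I M c
  | Var x, _ => s x
  | App f us, k'.+1 => fsym_I M [ffun i => interp_rec M k' s (us i)]
  | VApp G us, k'.+1 => vsym_I M G [seq interp_rec M k' s u | u <- us]
  | Ellipsis G u x v, k'.+1 =>
      vsym_I M G (mkseq (fun n => interp_rec M k' s (tsubst u x (Cst (num L n))))
                        (interp_rec M k' s v).+1)
  | _, 0 => 0
  end.

(* [interp M s r] is r^s. *)
Definition interp (L : language) (M : structure L) (s : assignment L)
    (r : term L) : nat :=
  interp_rec M (complexity r) s r.

Fixpoint tsubstitutable (L : language) (t : term L) (x : var L) (r : term L) :
    bool :=
  match r with
  | Cst _ | Var _ => true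
  | App f us => [forall i, tsubstitutable t x (us i)]
  | VApp _ us => all (fun u => tsubstitutable t x u) us
  | Ellipsis _ u y v =>
      [|| x \notin fv r,
          (y == x) && tsubstitutable t x v
        | [&& y \notin fv t, tsubstitutable t x u & tsubstitutable t x v]]
  end.

Fixpoint ffv (L : language) (phi : formula L) : seq (var L) :=
  match phi with
  | Pred p us => flatten [seq fv (us i) | i <- enum 'I_(psym_arity p)]
  | Equal u v => fv u ++ fv v
  | Not psi => ffv psi
  | And psi chi | Or psi chi | Imp psi chi | Iff psi chi => ffv psi ++ ffv chi
  | All y psi | Ex y psi => [seq z <- ffv psi | z != y]
  end.

(* [fsubst phi x t] is phi(x|t): free occurrences only, and bound variables are
   not renamed. *)
Fixpoint fsubst (L : language) (phi : formula L) (x : var L) (t : term L) :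
    formula L :=
  match phi with
  | Pred p us => Pred p [ffun i => tsubst (us i) x t]
  | Equal u v => Equal (tsubst u x t) (tsubst v x t)
  | Not psi => Not (fsubst psi x t)
  | And psi chi => And (fsubst psi x t) (fsubst chi x t)
  | Or psi chi => Or (fsubst psi x t) (fsubst chi x t)
  | Imp psi chi => Imp (fsubst psi x t) (fsubst chi x t)
  | Iff psi chi => Iff (fsubst psi x t) (fsubst chi x t)
  | All y psi => if y == x then All y psi else All y (fsubst psi x t)
  | Ex y psi => if y == x then Ex y psi else Ex y (fsubst psi x t)
  end.

Fixpoint fsubstitutable (L : language) (t : term L) (x : var L)
    (phi : formula L) : bool :=
  match phi with
  | Pred p us => [forall i, tsubstitutable t x (us i)]
  | Equal u v => tsubstitutable t x u && tsubstitutable t x v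
  | Not psi => fsubstitutable t x psi
  | And psi chi | Or psi chi | Imp psi chi | Iff psi chi =>
      fsubstitutable t x psi && fsubstitutable t x chi
  | All y psi | Ex y psi =>
      (x \notin ffv phi) || ((y \notin fv t) && fsubstitutable t x psi)
  end.

(* [sat M s phi] is M |= phi[s]. *)
Fixpoint sat (L : language) (M : structure L) (s : assignment L)
    (phi : formula L) : Prop :=
  match phi with
  | Pred p us => psym_I M [ffun i => interp M s (us i)]
  | Equal u v => interp M s u = interp M s v
  | Not psi => ~ sat M s psi
  | And psi chi => sat M s psi /\ sat M s chi
  | Or psi chi => sat M s psi \/ sat M s chi
  | Imp psi chi => sat M s psi -> sat M s chi
  | Iff psi chi => sat M s psi <-> sat M s chi
  | All y psi => forall n, sat M (update s y n) psi
  | Ex y psi => exists n, sat M (update s y n) psi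
  end.

Section Interpretation.
Variables (L : language) (M : structure L).
Implicit Types (s : assignment L) (r u v : term L) (x : var L).

Lemma complexity_arg (f : fsym L) (us : {ffun 'I_(fsym_arity f) -> term L}) i :
  complexity (us i) < complexity (App f us).
Proof. by rewrite /= ltnS; exact: leq_bigmax. Qed.

Lemma complexity_varg k (G : vsym L) (us : seq (term L)) :
  (complexity (VApp G us) <= k.+1) = all (fun u => complexity u <= k) us.
Proof. by rewrite /= ltnS; elim: us => //= u us IH; rewrite geq_max IH. Qed.

Lemma all_map_eq (T U : Type) (p : pred T) (g h : T -> U) (us : seq T) :
  (forall a, p a -> g a = h a) -> all p us -> map g us = map h us.
Proof. by move=> gh; elim: us => //= a us IH /andP[/gh-> /IH->]. Qed.

Lemma complexity_num_le k r x n :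
  complexity r <= k -> complexity (tsubst r x (Cst (num L n))) <= k.
Proof.
elim: k r => [|k IH] [c|y|f us|G us|G u y v] //=; try by case: ifP.
- move=> le_us; rewrite ltnS; apply/bigmax_leqP => i _; rewrite ffunE.
  by apply: IH; rewrite -ltnS; exact: leq_trans (complexity_arg us i) le_us.
- move: (complexity_varg k G us) => /= -> us_k.
  move: (complexity_varg k G [seq tsubst u x (Cst (num L n)) | u <- us]) => /= ->.
  by elim: us us_k => //= u us IHus /andP[/IH-> /IHus].
- by rewrite ltnS geq_max => /andP[uk vk]; case: ifP => _ /=;
    rewrite ltnS geq_max ?uk !IH.
Qed.

Lemma interp_recE k s r :
  complexity r <= k -> interp_rec M k s r = interp M s r.
Proof.
rewrite /interp; move: {2}(complexity r) (leqnn (complexity r)) => m.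
elim: m k r => [|m IH] [|k] [c|y|f us|G us|G u y v] //= cm ck.
- congr (fsym_I M _); apply/ffunP => i; rewrite !ffunE.
  have lt_i := complexity_arg us i; rewrite /= ltnS in lt_i.
  have im := leq_trans lt_i cm; have ik := leq_trans lt_i ck.
  have key j : complexity (us i) <= j -> interp_rec M j s (us i) = interp M s (us i).
    by move=> ij; apply: IH.
  by rewrite !key.
- congr (vsym_I M G _).
  pose c := foldr maxn 0 [seq complexity u | u <- us].
  have us_c : all (fun u => complexity u <= c) us.
    by rewrite -(complexity_varg c G).
  apply: all_map_eq us_c => u uc.
  have um := leq_trans uc cm; have uk := leq_trans uc ck.
  by rewrite (IH k) // (IH c).
- rewrite !ltnS in cm ck.
  have uc := leq_maxl (complexity u) (complexity v).
  have vc := leq_maxr (complexity u) (complexity v).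
  set c := maxn _ _ in cm ck uc vc *.
  have vm := leq_trans vc cm; have vk := leq_trans vc ck.
  have um := leq_trans uc cm; have uk := leq_trans uc ck.
  congr (vsym_I M G _); rewrite (IH k v) // (IH c v) //.
  by apply: eq_map => n; rewrite (IH k) ?(IH c) // complexity_num_le.
Qed.

Lemma interp_Cst s c : interp M s (Cst c) = cst_I M c.
Proof. by []. Qed.

Lemma interp_Var s x : interp M s (Var x) = s x.
Proof. by []. Qed.

Lemma interp_App s (f : fsym L) (us : {ffun 'I_(fsym_arity f) -> term L}) :
  interp M s (App f us) = fsym_I M [ffun i => interp M s (us i)].
Proof.
rewrite {1}/interp /=; congr (fsym_I M _); apply/ffunP => i; rewrite !ffunE.
by rewrite interp_recE // -ltnS; exact: complexity_arg.
Qed.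

Lemma interp_VApp s (G : vsym L) (us : seq (term L)) :
  interp M s (VApp G us) = vsym_I M G [seq interp M s u | u <- us].
Proof.
rewrite {1}/interp /=; congr (vsym_I M G _).
set c := foldr _ _ _; have us_c : all (fun u => complexity u <= c) us.
  by rewrite -(complexity_varg c G).
by apply: all_map_eq us_c => u uc; rewrite interp_recE.
Qed.

Lemma interp_Ellipsis s (G : vsym L) u x v :
  interp M s (Ellipsis G u x v) =
  vsym_I M G (mkseq (fun n => interp M s (tsubst u x (Cst (num L n))))
                    (interp M s v).+1).
Proof.
rewrite {1}/interp /=; congr (vsym_I M G _); rewrite interp_recE ?leq_maxr //.
by apply: eq_map => n; rewrite interp_recE // complexity_num_le // leq_maxl.
Qed.

End Interpretation.

(* Main.v *)
Require Import Defs.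
From mathcomp Require Import all_boot.
From Stdlib Require List.

(** The satisfaction relation sees a term only through its value, so everything
    rests on the substitution lemma for terms: the value of r(x|t) under s is
    the value of r under s(x|t^s).  A direct induction on r is awkward, because
    the value of G(u(0) ..._x u(v)) is defined through the terms u(x|n), which
    are not subterms.  The remedy is a second, compositional semantics [eval],
    in which ..._x is a binder: u is evaluated under the assignments s(x|n).

    For [eval], structural induction proves both that the value depends only on
    the free variables ([eval_agree]) and the substitution lemma
    ([eval_tsubst]).  At an ellipsis binding y there are three ways in which t
    can be substitutable: x is not free, and then nothing changes on either
    side; or y = x, and then u is left alone while the bound value of x hides
    t^s; or y is not free in t, and then t has the same value inside the scope
    of y as outside, so that the two updates commute.

    The two semantics agree ([interpE]): a constant symbol has no free
    variables, hence is substitutable everywhere, so the substitution lemma for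
    [eval] itself turns the value of u(x|n) under s into the value of u under
    s(x|n).  The theorem is then the classical induction on formulas, in which a
    quantifier is treated like an ellipsis. *)

Set Implicit Arguments.
Unset Strict Implicit.
Unset Printing Implicit Defensive.

(** * Terms: induction and free variables *)

(** The automatically generated principle gives no hypothesis on the arguments
    of a function symbol, which are nested inside finite functions and
    sequences. *)
Lemma term_nested_ind (L : language) (P : term L -> Prop) :
  (forall c, P (Cst c)) ->
  (forall x, P (Var x)) ->
  (forall (f : Defs.fsym L) (us : {ffun 'I_(fsym_arity f) -> term L}),
    (forall i, P (us i)) -> P (App f us)) ->
  (forall G us, List.Forall P us -> P (VApp G us)) ->
  (forall G u x v, P u -> P v -> P (Ellipsis G u x v)) ->
  forall r, P r.
Proof.
move=> PC PV PA PG PE; fix IH 1 => -[c|x|f us|G us|G u x v].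
- exact: PC.
- exact: PV.
- by apply: PA => i; apply: IH.
- by apply: PG; elim: us => [|u us IHus]; constructor.
- by apply: PE; apply: IH.
Qed.

Lemma mem_fv_arg (L : language) n (us : {ffun 'I_n -> term L}) i z :
  z \in fv (us i) -> z \in flatten [seq fv (us j) | j <- enum 'I_n].
Proof. by move=> z_ui; apply/flatten_mapP; exists i; rewrite ?mem_enum. Qed.

Lemma tsubst_notin (L : language) (r : term L) x t :
  x \notin fv r -> tsubst r x t = r.
Proof.
elim/term_nested_ind: r => [c|y|f us IH|G us IH|G u y v IHu IHv] //=.
- by rewrite inE eq_sym => /negPf->.
- move=> x_us; congr App; apply/ffunP => i; rewrite ffunE IH //.
  exact: contra (@mem_fv_arg _ _ us i x) x_us.
- move=> x_us; congr VApp; elim: IH x_us => //= u vs IHu _ IHvs.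
  by rewrite mem_cat negb_or => /andP[/IHu-> /IHvs->].
- rewrite mem_cat mem_filter negb_or eq_sym => /andP[+ /IHv->].
  by case: eqVneq => //= _ /IHu->.
Qed.

Lemma tsubstitutable_closed (L : language) (t : term L) x r :
  fv t = [::] -> tsubstitutable t x r.
Proof.
move=> t0; elim/term_nested_ind: r => [c|y|f us IH|G us IH|G u y v IHu IHv] //=.
- exact/forallP.
- by elim: IH => //= u vs -> _ ->.
- by rewrite t0 IHu IHv !orbT.
Qed.

(** * Updates of assignments *)

Section Updates.
Variable L : language.
Implicit Types (s : assignment L) (x y : var L).

Lemma update_shadow s x a n : update (update s x a) x n =1 update s x n.
Proof. by move=> z; rewrite /update; case: eqP. Qed.

Lemma update_comm s x y a n :
  y != x -> update (update s x a) y n =1 update (update s y n) x a.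
Proof.
by move=> yx z; rewrite /update; case: (eqVneq z y) => [->|//]; rewrite (negPf yx).
Qed.

(** The form in which agreement on free variables passes under a binder. *)
Lemma update_agree s s' y n (zs : seq (var L)) :
  {in [seq z <- zs | z != y], s =1 s'} ->
  {in zs, update s y n =1 update s' y n}.
Proof.
move=> ss' z zs_z; rewrite /update; case: eqVneq => // zy.
by apply: ss'; rewrite mem_filter zy.
Qed.

Lemma update_notin s x a (zs : seq (var L)) :
  x \notin zs -> {in zs, update s x a =1 s}.
Proof.
by move=> xzs z zzs; rewrite /update; case: eqP => // zx; rewrite -zx zzs in xzs.
Qed.

End Updates.

(** * Compositional semantics of terms *)

Section Semantics.
Variables (L : language) (M : structure L).
Implicit Types (s : assignment L) (r t u v : term L) (x y : var L).
Implicit Types (phi psi : formula L).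

(** The ellipsis is read as a binder: no substitution is made in u. *)
Fixpoint eval s r : nat :=
  match r with
  | Cst c => cst_I M c
  | Var x => s x
  | App f us => fsym_I M [ffun i => eval s (us i)]
  | VApp G us => vsym_I M G [seq eval s u | u <- us]
  | Ellipsis G u x v =>
      vsym_I M G (mkseq (fun n => eval (update s x n) u) (eval s v).+1)
  end.

Lemma eval_agree s s' r : {in fv r, s =1 s'} -> eval s r = eval s' r.
Proof.
elim/term_nested_ind: r s s' =>
  [c|y|f us IH|G us IH|G u y v IHu IHv] //= s s' ss'.
- by apply: ss'; rewrite inE.
- congr fsym_I; apply/ffunP => i; rewrite !ffunE; apply: IH => z /mem_fv_arg.
  exact: ss'.
- congr vsym_I; elim: IH ss' => //= u vs IHu _ IHvs ss'.
  congr (_ :: _); [apply: IHu|apply: IHvs] => z z_in; apply: ss';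
    by rewrite mem_cat z_in ?orbT.
- have -> : eval s v = eval s' v.
    by apply: IHv => z z_v; apply: ss'; rewrite mem_cat z_v orbT.
  congr vsym_I; apply: eq_map => n; apply: IHu; apply: update_agree => z z_u.
  by apply: ss'; rewrite mem_cat z_u.
Qed.

Lemma eval_ext s s' r : s =1 s' -> eval s r = eval s' r.
Proof. by move=> ss'; apply: eval_agree => z _. Qed.

Lemma eval_tsubst s r x t :
  tsubstitutable t x r ->
  eval s (tsubst r x t) = eval (update s x (eval s t)) r.
Proof.
elim/term_nested_ind: r s => [c|y|f us IH|G us IH|G u y v IHu IHv] s //.
- by move=> _ /=; rewrite /update; case: eqP.
- move=> /= /forallP t_us; congr fsym_I; apply/ffunP => i.
  by rewrite !ffunE IH.
- move=> /= t_us; congr vsym_I; elim: IH t_us => //= u vs IHu _ IHvs.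
  by case/andP=> /IHu-> /IHvs->.
case: (boolP (x \in fv (Ellipsis G u y v))) => [x_r | x_r _]; last first.
  by rewrite tsubst_notin //; apply/esym/eval_agree; exact: update_notin.
rewrite /= in x_r *; rewrite {}x_r /=.
case: (eqVneq y x) => [-> | yx] /= t_r.
  have -> : eval s (tsubst v x t) = eval (update s x (eval s t)) v.
    by apply: IHv; case/orP: t_r => [|/and3P[]].
  congr vsym_I; apply: eq_map => n; apply: eval_ext => z.
  by rewrite update_shadow.
case/and3P: t_r => y_t t_u t_v; rewrite (IHv s) //.
congr vsym_I; apply: eq_map => n; rewrite IHu //.
(* t has the same value inside and outside the scope of y *)
rewrite (eval_agree (update_notin s n y_t)).
by apply: eval_ext => z; rewrite (update_comm _ _ _ yx).
Qed.

(** Agreement of the two semantics is by induction on the complexity, which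
    substituting a constant symbol does not increase. *)
Lemma interpE s r : interp M s r = eval s r.
Proof.
have [k] := ubnP (complexity r).
elim: k s r => // k IH s [c|y|f us|G us|G u y v] r_k //.
- rewrite interp_App /=; congr fsym_I; apply/ffunP => i; rewrite !ffunE.
  by apply: IH; exact: leq_trans (complexity_arg us i) r_k.
- rewrite interp_VApp /=; congr vsym_I.
  move: r_k; rewrite ltnS.
  case: k IH => // k IH; rewrite complexity_varg.
  by apply: all_map_eq => u u_k; apply: IH.
- move: r_k; rewrite /= ltnS gtn_max => /andP[u_k v_k].
  rewrite interp_Ellipsis /= (IH s v) //; congr vsym_I; apply: eq_map => n.
  rewrite IH; last exact: leq_ltn_trans (complexity_num_le _ _ (leqnn _)) u_k.
  by rewrite eval_tsubst ?tsubstitutable_closed //= num_I.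
Qed.

Lemma interp_agree s s' r : {in fv r, s =1 s'} -> interp M s r = interp M s' r.
Proof. by rewrite !interpE; exact: eval_agree. Qed.

Lemma interp_tsubst s r x t :
  tsubstitutable t x r ->
  interp M s (tsubst r x t) = interp M (update s x (interp M s t)) r.
Proof. by rewrite !interpE; exact: eval_tsubst. Qed.

(** * Formulas *)

Lemma sat_agree s s' phi : {in ffv phi, s =1 s'} -> sat M s phi <-> sat M s' phi.
Proof.
have catl zs zs' s1 s2 : {in zs ++ zs', s1 =1 s2} -> {in zs, s1 =1 s2}.
  by move=> ss z z_in; apply: ss; rewrite mem_cat z_in.
have catr zs zs' s1 s2 : {in zs ++ zs', s1 =1 s2} -> {in zs', s1 =1 s2}.
  by move=> ss z z_in; apply: ss; rewrite mem_cat z_in orbT.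
elim: phi s s' => [p us|u v|psi IH|psi IHp chi IHc|psi IHp chi IHc
    |psi IHp chi IHc|psi IHp chi IHc|y psi IH|y psi IH] s s' /= ss';
  try by move: (IHp s s' (catl _ _ _ _ ss')) (IHc s s' (catr _ _ _ _ ss')); tauto.
- suff -> : [ffun i => interp M s (us i)] = [ffun i => interp M s' (us i)] by [].
  apply/ffunP => i; rewrite !ffunE; apply: interp_agree => z /mem_fv_arg.
  exact: ss'.
- by rewrite (interp_agree (catl _ _ _ _ ss')) (interp_agree (catr _ _ _ _ ss')).
- by move: (IH s s' ss'); tauto.
- have upd n := IH _ _ (update_agree n ss').
  by split=> sat_psi n; apply/upd.
- have upd n := IH _ _ (update_agree n ss').
  by split=> -[n sat_psi]; exists n; apply/upd.
Qed.

Lemma fsubst_notin phi x t : x \notin ffv phi -> fsubst phi x t = phi.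
Proof.
elim: phi => [p us|u v|psi IH|psi IHp chi IHc|psi IHp chi IHc
    |psi IHp chi IHc|psi IHp chi IHc|y psi IH|y psi IH] /=;
  try by rewrite mem_cat negb_or => /andP[/IHp-> /IHc->].
- move=> x_us; congr Pred; apply/ffunP => i; rewrite ffunE tsubst_notin //.
  exact: contra (@mem_fv_arg _ _ us i x) x_us.
- by rewrite mem_cat negb_or => /andP[??]; rewrite !tsubst_notin.
- by move=> /IH->.
- by rewrite mem_filter eq_sym; case: eqVneq => //= _ /IH->.
- by rewrite mem_filter eq_sym; case: eqVneq => //= _ /IH->.
Qed.

(** The vacuous case, separated because it is common to both quantifiers. *)
Lemma sat_fsubst_notin s phi x t :
  x \notin ffv phi ->
  sat M s (fsubst phi x t) <-> sat M (update s x (interp M s t)) phi.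
Proof.
move=> x_phi; rewrite fsubst_notin //; apply: iff_sym; apply: sat_agree.
exact: update_notin.
Qed.

(** The non-vacuous step under a binder y: t has the same value inside the
    scope of y as outside, and the two updates commute. *)
Lemma sat_fsubst_scope s psi x y t n :
  y != x -> y \notin fv t ->
  (forall s', sat M s' (fsubst psi x t) <->
              sat M (update s' x (interp M s' t)) psi) ->
  sat M (update s y n) (fsubst psi x t) <->
  sat M (update (update s x (interp M s t)) y n) psi.
Proof.
move=> yx y_t subst_psi; apply: iff_trans (subst_psi _) _.
rewrite (interp_agree (update_notin s n y_t)); apply: sat_agree => z _.
by rewrite (update_comm _ _ _ yx).
Qed.

End Semantics.

Theorem corollary11 (L : language) (M : structure L) (s : assignment L)
    (t : term L) (x : var L) (phi : formula L)
    (t_subst : fsubstitutable t x phi) :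
  sat M s (fsubst phi x t) <-> sat M (update s x (interp M s t)) phi.
Proof.
elim: phi s t_subst => [p us|u v|psi IH|psi IHp chi IHc|psi IHp chi IHc
    |psi IHp chi IHc|psi IHp chi IHc|y psi IH|y psi IH] s t_subst;
  try by case/andP: t_subst => /(IHp s) + /(IHc s) => /=; tauto.
- move/forallP: t_subst => t_us /=.
  set vs := [ffun i => _]; set ws := [ffun i => _]; suff -> : vs = ws by [].
  by apply/ffunP => i; rewrite !ffunE interp_tsubst.
- by case/andP: t_subst => t_u t_v /=; rewrite !interp_tsubst.
- by move: (IH s t_subst) => /=; tauto.
- case: (boolP (x \in ffv (All y psi))) => [x_phi|]; last exact: sat_fsubst_notin.
  move: (x_phi) t_subst; rewrite /= => -> /= /andP[y_t t_psi].
  move: x_phi; rewrite mem_filter eq_sym => /andP[yx _]; rewrite (negPf yx) /=.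
  have scope n := sat_fsubst_scope s n yx y_t (IH^~ t_psi).
  by split=> sat_psi n; apply/scope.
- case: (boolP (x \in ffv (Ex y psi))) => [x_phi|]; last exact: sat_fsubst_notin.
  move: (x_phi) t_subst; rewrite /= => -> /= /andP[y_t t_psi].
  move: x_phi; rewrite mem_filter eq_sym => /andP[yx _]; rewrite (negPf yx) /=.
  have scope n := sat_fsubst_scope s n yx y_t (IH^~ t_psi).
  by split=> -[n sat_psi]; exists n; apply/scope.
Qed.
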